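(* Let $b_0<0$ and $b_1\in\mathbb{R}$ be constants, and consider the eigenvalue problem $$b_0y''(x)+b_1y'(x)=\lambda y(x),\quad x\in(0,1),\qquad y(0)=y\left(\tfrac12\right)=y(1).$$ Assume $b_1\neq 0$. Then each eigenvalue of this problem is algebraically and geometrically simple.
   Context: Eigenvalues and their multiplicities are those of the operator $L$ in $L^2_w((0,1),\mathbb{C})$ with weight $w=-1/b_0$ (here a positive constant), defined by $Ly=b_0y''+b_1y'$ on $$\mathrm{dom}(L)=\{y\in L^2_w((0,1),\mathbb{C}) : y,y'\in AC[0,1],\ Ly\in L^2_w((0,1),\mathbb{C}),\ y(0)=y(\tfrac12)=y(1)\},$$ where $AC[0,1]$ is the set of absolutely continuous functions on $[0,1]$. The geometric multiplicity of an eigenvalue $\lambda_0$ is $\dim\ker(L-\lambda_0I)$ and its algebraic multiplicity is $\dim\bigcup_{n=1}^\infty\ker((L-\lambda_0I)^n)$. An eigenvalue is called geometrically (respectively algebraically) simple if its geometric (respectively algebraic) multiplicity equals $1$. *)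

(* Defs.v *)
From HB Require Import structures.
From mathcomp Require Import all_boot all_order all_algebra.
From mathcomp Require Import complex.
From mathcomp Require Import all_classical all_reals all_analysis.

Set Implicit Arguments.
Unset Strict Implicit.
Unset Printing Implicit Defensive.

Import Order.TTheory GRing.Theory Num.Theory.
Import numFieldNormedType.Exports.

Local Open Scope classical_set_scope.
Local Open Scope ring_scope.
Local Open Scope complex_scope.

(* An element of L^2_w((0,1), C) is represented by a function R -> R[i], and
   two functions represent the same element when they agree almost everywhere
   on ]0, 1[ ([ae_eq01]); values outside ]0, 1[ are irrelevant. *)
Definition ae_eq01 (R : realType) (f g : R -> R[i]) : Prop :=
  {ae lebesgue_measure, forall x : R, `]0, 1[%classic x -> f x = g x}.

(* [measurable_fun] on R means Borel measurable, which is not stable under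
   equality a.e.; membership in L^2_w asks for a measurable representative g. *)
Definition L2w (R : realType) (w : R) (f : R -> R[i]) : Prop :=
  exists2 g : R -> R[i], ae_eq01 f g &
  [/\ measurable_fun (`]0, 1[%classic : set R) (fun x => complex.Re (g x)),
      measurable_fun (`]0, 1[%classic : set R) (fun x => complex.Im (g x)) &
      (\int[lebesgue_measure]_(x in `]0%R, 1%R[)
         ((Normc.normc (g x) ^+ 2 * w)%:E) < +oo)%E].

Definition AC (R : realType) (a b : R) (f : R -> R[i]) : Prop :=
  forall e : R, 0 < e -> exists2 d : R, 0 < d &
    forall (n : nat) (s t : 'I_n -> R),
      (forall i, [&& a <= s i, s i <= t i & t i <= b]) ->
      trivIset setT (fun i => `]s i, t i[%classic) ->
      \sum_(i < n) (t i - s i) < d ->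
      \sum_(i < n) Normc.normc (f (t i) - f (s i)) < e.

(* The derivative of a complex-valued function of a real variable is taken
   componentwise, R[i] being no normed module over R in the library. *)
Definition is_cderive (R : realType) (x : R) (f : R -> R[i]) (df : R[i]) : Prop :=
  is_derive x (1 : R) (fun t => complex.Re (f t)) (complex.Re df) /\
  is_derive x (1 : R) (fun t => complex.Im (f t)) (complex.Im df).

(* Unbounded operators in L^2_w are given by their graphs: [T y f] means that
   y is in the domain of T and that T y = f, as elements of L^2_w. *)

(* The graph of L y = b0 y'' + b1 y'. Here Y is the absolutely continuous
   representative of y and Y1 its derivative on ]0, 1[, extended to [0, 1].
   As Y1 is absolutely continuous, its derivative Y2 exists a.e. only. *)
Definition opL (R : realType) (b0 b1 : R) (y f : R -> R[i]) : Prop :=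
  let w := - b0^-1 in
  [/\ L2w w y, L2w w f &
    exists Y Y1 Y2 : R -> R[i],
      [/\ ae_eq01 y Y,
          AC 0 1 Y /\ AC 0 1 Y1,
          (forall x : R, 0 < x < 1 -> is_cderive x Y (Y1 x)) /\
            {ae lebesgue_measure, forall x : R, `]0, 1[%classic x ->
               is_cderive x Y1 (Y2 x)},
          ae_eq01 f (fun x => b0%:C * Y2 x + b1%:C * Y1 x) &
          Y 0 = Y (2^-1) /\ Y (2^-1) = Y 1]].

Definition op_sub_scalar (R : realType) (T : (R -> R[i]) -> (R -> R[i]) -> Prop)
    (lam : R[i]) (y f : R -> R[i]) : Prop :=
  exists2 g, T y g & ae_eq01 f (fun x => g x - lam * y x).

Fixpoint op_pow (R : realType) (T : (R -> R[i]) -> (R -> R[i]) -> Prop)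
    (n : nat) (y f : R -> R[i]) : Prop :=
  if n is m.+1 then exists2 g, T y g & op_pow T m g f else ae_eq01 y f.

Definition op_ker (R : realType) (T : (R -> R[i]) -> (R -> R[i]) -> Prop)
    (y : R -> R[i]) : Prop :=
  T y (fun=> 0).

(* V is a linear subspace of functions modulo [ae_eq01], of dimension d. *)
Definition has_dim (R : realType) (V : (R -> R[i]) -> Prop) (d : nat) : Prop :=
  exists e : 'I_d -> R -> R[i],
    (forall c : 'I_d -> R[i],
       ae_eq01 (fun x => \sum_(i < d) c i * e i x) (fun=> 0) ->
       forall i, c i = 0) /\
    (forall y, V y <->
       exists c : 'I_d -> R[i], ae_eq01 y (fun x => \sum_(i < d) c i * e i x)).

Definition eigenvalueL (R : realType) (b0 b1 : R) (lam : R[i]) : Prop :=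
  exists2 y, op_ker (op_sub_scalar (opL b0 b1) lam) y & ~ ae_eq01 y (fun=> 0).

Definition geom_mult (R : realType) (b0 b1 : R) (lam : R[i]) (d : nat) : Prop :=
  has_dim (op_ker (op_sub_scalar (opL b0 b1) lam)) d.

Definition alg_mult (R : realType) (b0 b1 : R) (lam : R[i]) (d : nat) : Prop :=
  has_dim (fun y => exists2 n : nat, (0 < n)%N &
             op_ker (op_pow (op_sub_scalar (opL b0 b1) lam) n) y) d.

(* Main.v *)
Require Import Defs.
From mathcomp Require Import all_boot all_order all_algebra.
From mathcomp Require Import complex.
From mathcomp Require Import all_classical all_reals all_analysis.
From mathcomp Require Import measurable_realfun.
From mathcomp Require Import ring lra.

(** The proof has an analytic half and an algebraic half.

    Analytic half: an absolutely continuous function whose derivative vanishes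
    almost everywhere is constant ([AC_ae_derive0_const]).  Multiplying by an
    exponential, a solution of u' = r u almost everywhere is C exp (r x)
    everywhere on [0, 1] ([AC_linear_ode]).  Let r1, r2 be the roots of
    b0 r^2 + b1 r - lam; then L - lam = b0 (D - r1) (D - r2), and
    y' - r2 y and y' - r1 y are multiples of exp (r1 x) and exp (r2 x).  So
    the elements of ker (L - lam) are c1 exp (r1 x) + c2 exp (r2 x) when
    r1 != r2, and (c1 x + c2) exp (r1 x) when r1 = r2.

    Algebraic half: put ei = exp (ri / 2).  The boundary conditions read
    c1 (e1 - 1) + c2 (e2 - 1) = 0 and c1 e1 (e1 - 1) + c2 e2 (e2 - 1) = 0, and
    e1 e2 = exp (- b1 / (2 b0)) is a positive real number other than 1, as
    b1 != 0.  Hence e1 and e2 are not both 1, the first equation is nontrivial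
    and the kernel has dimension at most one ([bvp_proportional]).  A double
    root r1 = r2 gives no eigenfunction ([bvp_double_root]).

    It remains to see that ker (L - lam)^2 = ker (L - lam).  If
    (L - lam) z = g with g in the kernel, a particular solution is
    x (2 g' - (r1 + r2) g) / (b0 (r1 - r2)^2), a multiple of
    x (c1 exp (r1 x) - c2 exp (r2 x)); subtracting it from z leaves a
    combination of the two exponentials, and the boundary conditions for z then
    force c1 = c2 = 0 ([bvp_no_chain], [bc_chain]).  So no Jordan chain has
    length two. *)

Set Implicit Arguments.
Unset Strict Implicit.
Unset Printing Implicit Defensive.

Import Order.TTheory GRing.Theory Num.Theory.
Import numFieldNormedType.Exports.

Local Open Scope classical_set_scope.
Local Open Scope ring_scope.
Local Open Scope complex_scope.

(** * Absolutely continuous functions with null derivative *)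

Section Complex.
Variable R : realType.
Implicit Types (x y t a b e : R) (f g : R -> R[i]) (z : R[i]).

Local Notation normc := (@Normc.normc R).

Lemma normcD z1 z2 : normc (z1 + z2) <= normc z1 + normc z2.
Proof. exact: (@le_normcD R z1 z2). Qed.

Lemma normcN z : normc (- z) = normc z.
Proof. exact: (@normcN R z). Qed.

Lemma normc_ge0 z : 0 <= normc z.
Proof. by case: z => u v; exact: sqrtr_ge0. Qed.

Lemma normc_le_ReIm z : normc z <= `|complex.Re z| + `|complex.Im z|.
Proof.
case: z => u v /=; rewrite -[leRHS]ger0_norm ?addr_ge0// -sqrtr_sqr ler_sqrt ?sqr_ge0//.
rewrite sqrrD !real_normK ?num_real// -addrA lerD2l lerDr mulrn_wge0//.
Qed.

Lemma normc_ge_ReIm z : `|complex.Re z| <= normc z /\ `|complex.Im z| <= normc z.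
Proof.
by case: z => u v /=; rewrite -!sqrtr_sqr; split;
  rewrite ler_sqrt ?addr_ge0 ?sqr_ge0// ?lerDl ?lerDr sqr_ge0.
Qed.

Lemma is_derive0_small (h : R -> R) x e : 0 < e -> is_derive x (1 : R) h 0 ->
  exists2 d : R, 0 < d & forall t, `|t - x| < d -> `|h t - h x| <= e * `|t - x|.
Proof.
move=> e0 [dh h0].
have : (fun k : R => k^-1 *: ((h \o shift x) (k *: (1 : R)) - h x)) @ 0^' --> (0 : R).
  by rewrite -[X in _ --> X]h0; exact: dh.
move/cvgrPdist_le => /(_ e e0) [d /= d0 hd].
exists d => // t td.
have [->|tx] := eqVneq t x; first by rewrite !subrr normr0 mulr0.
have tx0 : t - x != 0 by rewrite subr_eq0.
have := hd (t - x).
rewrite /= !sub0r !normrN => /(_ td tx0).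
rewrite /shift /= /GRing.scale /= mulr1 subrK normrM normfV => H.
by rewrite -ler_pdivrMr ?normr_gt0// mulrC.
Qed.

Lemma is_cderive0_small f x e : 0 < e -> is_cderive x f 0 ->
  exists2 d : R, 0 < d & forall t, `|t - x| < d -> normc (f t - f x) <= e * `|t - x|.
Proof.
move=> e0 [/= fr fi].
have e20 : 0 < e / 2 by rewrite divr_gt0.
have [d1 d10 h1] := is_derive0_small e20 fr.
have [d2 d20 h2] := is_derive0_small e20 fi.
exists (Num.min d1 d2) => [|t]; first by rewrite lt_min d10.
rewrite lt_min => /andP[t1 t2].
apply: le_trans (normc_le_ReIm _) _.
rewrite [e in leRHS]splitr mulrDl.
have := lerD (h1 t t1) (h2 t t2).
by case: (f t) => u v; case: (f x) => u' v'.
Qed.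

Lemma AC_sub f a b a' b' : a <= a' -> b' <= b -> Defs.AC a b f -> Defs.AC a' b' f.
Proof.
move=> aa bb fAC e e0; have [d d0 H] := fAC e e0; exists d => // n s t hst.
apply: H => i; have /and3P[h1 h2 h3] := hst i.
by rewrite (le_trans aa h1) h2 (le_trans h3 bb).
Qed.

(** The finite families of intervals to which absolute continuity is applied, G
    being a small open neighborhood of the exceptional points.  The intervals
    are listed from right to left, so that adding one on the right is a cons. *)
Definition chain_in (G : set R) a t (l : seq (R * R)) :=
  [/\ forall p, p \in l -> [&& a <= p.1, p.1 <= p.2 & p.2 <= t],
      pairwise (fun p q : R * R => q.2 <= p.1) l &
      forall p, p \in l -> `]p.1, p.2[ `<=` G].

Lemma chain_in_trivIset G a t l : chain_in G a t l ->
  trivIset setT (fun i : 'I_(size l) => `](nth (0, 0) l i).1, (nth (0, 0) l i).2[%classic).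
Proof.
move=> [_ /(pairwiseP (0, 0)) pw _].
apply/trivIsetP => i j _ _.
wlog ij : i j / (i < j)%N.
  move=> H; have [ij|ji|/val_inj ->] := ltngtP i j; [exact: H| |by rewrite eqxx].
  by rewrite eq_sym setIC; exact: H.
move=> _; rewrite -subset0 => z [] /=; rewrite !in_itv /= => /andP[z1 _] /andP[_ z2].
have := pw i j (ltn_ord i) (ltn_ord j) ij.
by rewrite leNgt (lt_trans z1 z2).
Qed.

Lemma chain_in_length G a t l : open G -> chain_in G a t l ->
  ((\sum_(i < size l) ((nth (0, 0) l i).2 - (nth (0, 0) l i).1))%:E <=
     lebesgue_measure G)%E.
Proof.
move=> oG cl; have tI := chain_in_trivIset cl; have [lat _ lG] := cl.
set F := fun i : 'I_(size l) => _ in tI.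
rewrite -sumEFin.
have -> : (\sum_(i < size l) ((nth (0, 0) l i).2 - (nth (0, 0) l i).1)%:E =
    \sum_(i < size l) lebesgue_measure (F i))%E.
  apply: eq_bigr => i _; rewrite /F lebesgue_measure_itv /= lte_fin.
  have /and3P[_ + _] := lat _ (mem_nth (0, 0) (ltn_ord i)).
  rewrite le_eqVlt => /orP[/eqP ->|->]; last by rewrite EFinB.
  by rewrite ltxx subrr.
rewrite -measure_bigsetU_ord//=; last by move=> i; exact: measurable_itv.
apply: le_measure; rewrite ?inE.
- by apply: bigsetU_measurable => i _; exact: measurable_itv.
- exact: open_measurable.
- apply: (big_ind (fun A => A `<=` G)) => [z []|A B AG BG|i _].
  + by rewrite subUset.
  + exact: lG (mem_nth (0, 0) (ltn_ord i)).
Qed.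

(** Cousin's covering argument, as an induction on the reals: near a point with
    null derivative the increment of f is at most e times the length, and near
    a point of G it is charged to an interval of the chain.  The supremum of the
    points that are reached from a is therefore b. *)
Lemma gauge_chain f (G : set R) a b e : a <= b -> 0 < e -> open G ->
  (forall x, a <= x <= b -> G x \/ is_cderive x f 0) ->
  exists2 l, chain_in G a b l &
    normc (f b - f a) <= e * (b - a) +
      \sum_(p <- l) normc (f p.2 - f p.1).
Proof.
move=> ab e0 oG Gf.
pose P t := exists2 l, chain_in G a t l & normc (f t - f a) <= e * (t - a) +
      \sum_(p <- l) normc (f p.2 - f p.1).
pose A := [set t | a <= t <= b /\ P t].
have Aa : A a.
  split; first by rewrite lexx.
  exists [::]; first by split.
  by rewrite !subrr big_nil mulr0 addr0 Normc.normc0.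
have hsA : has_sup A by split; [exists a|exists b => t [/andP[_ ?] _]].
set c := sup A.
have ac : a <= c by apply: ub_le_sup => //; exact: hsA.2.
have cb : c <= b by apply: ge_sup => [|t [/andP[]]]; [exists a|].
(* Close to c, the property passes from any point on the left to any point on
   the right: across one interval inside G, or by the derivative at c. *)
have [d d0 step] : exists2 d : R, 0 < d & forall t u, c - d < t -> t <= c -> c <= u ->
    u < c + d -> u <= b -> a <= t -> P t -> P u.
  have acb : a <= c <= b by rewrite ac.
  have [Gc|dc] := Gf c acb.
    have [d /= d0 dG] : nbhs c G by exact: open_nbhs_nbhs.
    exists d => // t u t1 t2 u1 u2 ub at_ [l [l1 l2 l3] ht].
    exists ((t, u) :: l).
      split.
      - move=> p; rewrite inE => /predU1P[->|/l1/and3P[-> -> pt]] /=.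
          by rewrite at_ (le_trans t2 u1) lexx.
        by rewrite (le_trans pt)// (le_trans t2).
      - rewrite /= l2 andbT; apply/allP => p /l1 /and3P[_ _]; exact.
      - move=> p; rewrite inE => /predU1P[->|/l3//] /= z /=.
        rewrite in_itv/= => /andP[z1 z2]; apply: dG; rewrite /ball/= ltr_norml.
        by apply/andP; split; lra.
    rewrite big_cons /=.
    have -> : f u - f a = (f u - f t) + (f t - f a) by rewrite addrA subrK.
    apply: le_trans (normcD _ _) _.
    rewrite addrCA lerD2l (le_trans ht)// lerD2r ler_pM2l// lerD2r.
    exact: le_trans u1.
  have [d d0 hd] := is_cderive0_small e0 dc.
  exists d => // t u t1 t2 u1 u2 ub at_ [l [l1 l2 l3] ht].
  exists l.
    split=> // p /l1/and3P[-> -> pt] /=.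
    by rewrite (le_trans pt)// (le_trans t2).
  have -> : f u - f a = (f u - f c) + (- (f t - f c) + (f t - f a)).
    by rewrite opprB addrA subrKA addrA subrK.
  have hu : normc (f u - f c) <= e * (u - c).
    by have := hd u; rewrite ger0_norm ?subr_ge0//; apply; lra.
  have hT : normc (- (f t - f c)) <= e * (c - t).
    rewrite normcN; have := hd t; rewrite distrC ger0_norm ?subr_ge0//.
    by apply; lra.
  apply: le_trans (normcD _ _) _; apply: le_trans (lerD hu (normcD _ _)) _.
  apply: le_trans (lerD (lexx _) (lerD hT ht)) _.
  by rewrite !addrA lerD2r -!mulrDr ler_pM2l//; lra.
have [t At tc] := sup_adherent d0 hsA.
have tlec : t <= c by apply: ub_le_sup => //; exact: hsA.2.
have [/andP[at_ tb] Pt] := At.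
have PU u : c <= u -> u < c + d -> u <= b -> P u.
  by move=> cu ud ub; apply: (step t u).
have [cltb|] := ltP c b; last first.
  by move=> bc; apply: PU => //; rewrite (le_lt_trans bc)// ltrDl.
pose u := Num.min b (c + d / 2).
have cu : c < u by rewrite lt_min cltb ltrDl divr_gt0.
have ub : u <= b by rewrite ge_min lexx.
have ud : u < c + d by rewrite gt_min ltrD2l ltr_pdivrMr// mulr_natr mulr2n ltrDl d0 orbT.
have : u <= c.
  apply: ub_le_sup; first exact: hsA.2.
  by split; [rewrite ub (le_trans ac (ltW cu))|apply: PU => //; exact: ltW].
by rewrite leNgt cu.
Qed.

(** Take for G an open set of small measure that contains the exceptional null
    set.  Absolute continuity makes the increments over the chain in G small,
    and the remaining increments add up to at most e (b - a). *)
Lemma AC_ae_derive0_const f a b : a <= b -> Defs.AC a b f ->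
  {ae lebesgue_measure, forall x, `]a, b[%classic x -> is_cderive x f 0} -> f b = f a.
Proof.
move=> ab fAC [N [mN N0 Nf]].
apply/eqP; rewrite -subr_eq0; apply/eqP/Normc.eq0_normc/eqP.
rewrite eq_le normc_ge0 andbT; apply/ler_addgt0Pr => e e0; rewrite add0r.
have e20 : 0 < e / 2 by rewrite divr_gt0.
have [d d0 fd] := fAC _ e20.
(* Nothing is known about the derivative at the endpoints: they are exceptional too. *)
pose M := N `|` [set a; b].
have mM : measurable M.
  by apply: measurableU => //; apply: measurableU; exact: measurable_set1.
have M0 : lebesgue_measure M = 0%E.
  apply: null_set_setU => //.
  - by apply: measurableU; exact: measurable_set1.
  - by apply: null_set_setU => //; exact: lebesgue_measure_set1.
have [|G [oG MG Gd]] := lebesgue_regularity_outer mM _ d0.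
  by rewrite [X in (X < _)%E](_ : _ = 0%E)//.
have Gltd : (lebesgue_measure G < d%:E)%E.
  rewrite -(setDUK MG) measureU//=.
  - by rewrite M0 add0e.
  - by apply: measurableD => //; exact: open_measurable.
  - by rewrite setDE setICA setICr setI0.
have k0 : 0 < e / 2 / (b - a + 1) by rewrite divr_gt0// ltr_wpDl// subr_ge0.
have [|l cl fl] := gauge_chain ab k0 oG _ (f := f).
  move=> x /andP[ax xb].
  have [->|xa] := eqVneq x a; first by left; apply: MG; right; left.
  have [->|xnb] := eqVneq x b; first by left; apply: MG; right; right.
  have [Nx|Nx] := pselect (N x); first by left; apply: MG; left.
  right; apply: contrapT => nf; apply: Nx; apply: Nf => H; apply: nf; apply: H => /=.
  by rewrite in_itv/= !lt_neqAle ax xb xnb eq_sym xa.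
have := chain_in_length oG cl => /le_lt_trans/(_ Gltd); rewrite lte_fin => ld.
have := fd (size l) (fun i => (nth (0, 0) l i).1) (fun i => (nth (0, 0) l i).2) _
  (chain_in_trivIset cl) ld.
have [lab _ _] := cl.
move=> /(_ (fun i => lab _ (mem_nth _ (ltn_ord i)))) fs.
apply: (le_trans fl); rewrite [e in leRHS]splitr; apply: lerD.
  rewrite mulrAC ler_pdivrMr ?ler_pM2l//; first by rewrite lerDl.
  by rewrite ltr_wpDl// subr_ge0.
by rewrite (big_nth (0, 0)) big_mkord ltW.
Qed.
End Complex.

(** * First-order linear equations *)

Section AlmostEverywhere.
Variable R : realType.
Implicit Types P Q : R -> Prop.

(** With this name, [ae_eq01 f g] is convertible to [ae01 (fun x => f x = g x)]. *)
Definition ae01 P := {ae lebesgue_measure, forall x : R, `]0, 1[%classic x -> P x}.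

Lemma ae01W P : (forall x, 0 < x < 1 -> P x) -> ae01 P.
Proof.
move=> H; apply: (@filterE _ _ (ae_filter_ringOfSetsType (@lebesgue_measure R))) => x /=.
by rewrite in_itv; exact: H.
Qed.

Lemma ae01S P Q : (forall x, 0 < x < 1 -> P x -> Q x) -> ae01 P -> ae01 Q.
Proof.
move=> PQ; apply: (@filterS _ _ (ae_filter_ringOfSetsType (@lebesgue_measure R))) => x /= H x01.
by apply: PQ (H x01); move: x01; rewrite in_itv.
Qed.

Lemma ae01I P Q : ae01 P -> ae01 Q -> ae01 (fun x => P x /\ Q x).
Proof.
move=> Px Qx; have := @filterI _ _ (ae_filter_ringOfSetsType (@lebesgue_measure R)) _ _ Px Qx.
apply: (@filterS _ _ (ae_filter_ringOfSetsType (@lebesgue_measure R))) => x [H1 H2] x01.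
by split; [exact: H1|exact: H2].
Qed.

End AlmostEverywhere.

Section Calculus.
Variable R : realType.
Implicit Types (x y t a b e : R) (f g : R -> R[i]) (z r : R[i]).

Local Notation normc := (@Normc.normc R).
Local Notation AC := (@Defs.AC R).

Lemma is_cderive_cst x z : is_cderive x (fun=> z) 0.
Proof. by split; exact: is_derive_cst. Qed.

Lemma is_cderive_id x : is_cderive x (fun t => t%:C) 1.
Proof. by split; [exact: is_derive_id|exact: is_derive_cst]. Qed.

Lemma is_cderiveD x f g df dg : is_cderive x f df -> is_cderive x g dg ->
  is_cderive x (fun t => f t + g t) (df + dg).
Proof.
move=> [f1 f2] [g1 g2]; split.
  have -> : (fun t => complex.Re (f t + g t)) =
      (fun t => complex.Re (f t)) + (fun t => complex.Re (g t)).
    by apply/funext => t /=; rewrite !fctE; case: (f t) (g t) => ? ? [].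
  by apply: is_derive_eq; case: (df) (dg) => ? ? [].
have -> : (fun t => complex.Im (f t + g t)) =
    (fun t => complex.Im (f t)) + (fun t => complex.Im (g t)).
  by apply/funext => t /=; rewrite !fctE; case: (f t) (g t) => ? ? [].
by apply: is_derive_eq; case: (df) (dg) => ? ? [].
Qed.

Lemma is_cderiveM x f g df dg : is_cderive x f df -> is_cderive x g dg ->
  is_cderive x (fun t => f t * g t) (df * g x + f x * dg).
Proof.
move=> [f1 f2] [g1 g2]; split.
  have -> : (fun t => complex.Re (f t * g t)) =
      (fun t => complex.Re (f t)) * (fun t => complex.Re (g t)) -
      (fun t => complex.Im (f t)) * (fun t => complex.Im (g t)).
    by apply/funext => t /=; rewrite !fctE; case: (f t) (g t) => ? ? [].
  apply: is_derive_eq; rewrite /GRing.scale /=.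
  by case: (df) (dg) (f x) (g x) => ? ? [? ?] [? ?] [? ?] /=; ring.
have -> : (fun t => complex.Im (f t * g t)) =
    (fun t => complex.Re (f t)) * (fun t => complex.Im (g t)) +
    (fun t => complex.Im (f t)) * (fun t => complex.Re (g t)).
  by apply/funext => t /=; rewrite !fctE; case: (f t) (g t) => ? ? [].
apply: is_derive_eq; rewrite /GRing.scale /=.
by case: (df) (dg) (f x) (g x) => ? ? [? ?] [? ?] [? ?] /=; ring.
Qed.

Lemma is_cderiveZ x z f df : is_cderive x f df ->
  is_cderive x (fun t => z * f t) (z * df).
Proof.
move=> fx; have := is_cderiveM (is_cderive_cst x z) fx.
by rewrite mul0r add0r.
Qed.

(** The function exp (r x) of the real variable x, for a complex r. *)
Definition cexp r x : R[i] :=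
  expR (complex.Re r * x) * cos (complex.Im r * x) +i*
  (expR (complex.Re r * x) * sin (complex.Im r * x)).

Lemma cexp0 r : cexp r 0 = 1.
Proof.
by rewrite /cexp !mulr0 expR0 cos0 sin0 mulr0 mulr1.
Qed.

Lemma cexpDr r x y : cexp r (x + y) = cexp r x * cexp r y.
Proof.
rewrite /cexp !mulrDr expRD cosD sinD.
by apply/eqP; rewrite eq_complex /=; apply/andP; split; apply/eqP; ring.
Qed.

Lemma cexpDl r r' x : cexp (r + r') x = cexp r x * cexp r' x.
Proof.
case: r r' => u v [u' v']; rewrite /cexp /= !mulrDl expRD cosD sinD.
by apply/eqP; rewrite eq_complex /=; apply/andP; split; apply/eqP; ring.
Qed.

Lemma cexpNK r x : cexp (- r) x * cexp r x = 1.
Proof. by rewrite -cexpDl addNr /cexp /= !mul0r expR0 cos0 sin0 mulr1 mulr0. Qed.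

Lemma cexp_real (s : R) x : cexp s%:C x = (expR (s * x))%:C.
Proof. by rewrite /cexp /= mul0r cos0 sin0 mulr1 mulr0. Qed.

Lemma normc_cexp r x : normc (cexp r x) = expR (complex.Re r * x).
Proof.
rewrite /= !exprMn -mulrDr cos2Dsin2 mulr1 sqrtr_sqr ger0_norm//.
Qed.

Lemma is_derive_scaled (h : R -> R) (k dh x : R) :
  is_derive (k * x) (1 : R) h dh -> is_derive x (1 : R) (fun t => h (k * t)) (k * dh).
Proof.
move=> hx; have kx : is_derive x (1 : R) (fun t : R => k * t) k.
  by apply: is_derive_eq; rewrite /GRing.scale /= mulr1.
by apply: is_derive_eq (is_derive1_comp hx kx) _; rewrite /GRing.scale /= mulrC.
Qed.

Lemma is_cderive_cexp r x : is_cderive x (cexp r) (r * cexp r x).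
Proof.
have De := is_derive_scaled (is_derive_expR (complex.Re r * x)).
have Dc := is_derive_scaled (is_derive_cos (complex.Im r * x)).
have Ds := is_derive_scaled (is_derive_sin (complex.Im r * x)).
split.
  apply: (is_derive_eq (is_deriveM De Dc)).
  by rewrite /GRing.scale /=; case: (r) => u v /=; ring.
apply: (is_derive_eq (is_deriveM De Ds)).
by rewrite /GRing.scale /=; case: (r) => u v /=; ring.
Qed.

Lemma AC_dist f : AC 0 1 f -> forall e, 0 < e -> exists2 d : R, 0 < d &
  forall s t, 0 <= s -> s <= t -> t <= 1 -> t - s < d -> normc (f t - f s) < e.
Proof.
move=> fAC e e0; have [d d0 H] := fAC _ e0; exists d => // s t s0 st t1 tsd.
have := H 1%N (fun=> s) (fun=> t); rewrite !big_ord1; apply => //.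
  by move=> _; rewrite s0 st.
by apply/trivIsetP => i j _ _; rewrite !ord1 eqxx.
Qed.

(** Cut [0, x] into steps shorter than the d that absolute continuity gives for
    e = 1: over each of them f moves by less than 1. *)
Lemma AC_bounded f : AC 0 1 f ->
  exists2 B : R, 0 < B & forall x, 0 <= x <= 1 -> normc (f x) <= B.
Proof.
move=> fAC; have [d d0 H] := AC_dist fAC ltr01.
have step (k : nat) x : 0 <= x -> x <= 1 -> x <= k%:R * (d / 2) ->
    normc (f x) <= normc (f 0) + k%:R.
  elim: k x => [|k IH] x x0 x1.
    by rewrite mul0r addr0 => x00; have -> : x = 0 by apply/eqP; rewrite eq_le x00.
  rewrite -natr1 mulrDl mul1r addrA => xk.
  have [xd|dx] := leP x (d / 2).
    have := H 0 x (lexx _) x0 x1; rewrite subr0 => /(_ _)/ltW-/(_ ltac:(lra)) h.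
    rewrite -(subrK (f 0) (f x)); apply: le_trans (normcD _ _) _.
    by have := ler0n R k; lra.
  have h1 := IH (x - d / 2) ltac:(lra) ltac:(lra) ltac:(lra).
  have /ltW h2 := H (x - d / 2) x ltac:(lra) ltac:(lra) ltac:(lra) ltac:(lra).
  rewrite -(subrK (f (x - d / 2)) (f x)); apply: le_trans (normcD _ _) _.
  by lra.
have d20 : 0 < d / 2 by rewrite divr_gt0.
exists (normc (f 0) + (Num.bound (1 / (d / 2)))%:R + 1).
  by rewrite ltr_wpDl// addr_ge0// normc_ge0.
move=> x /andP[x0 x1]; rewrite ler_wpDr//; apply: step => //.
rewrite -ler_pdivrMr//; apply: le_trans (_ : 1 / (d / 2) <= _).
  by rewrite ler_pM2r ?invr_gt0.
by apply/ltW/archi_boundP; rewrite divr_ge0// ltW.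
Qed.

Lemma AC_lipschitz f (K : R) :
  (forall s t, 0 <= s -> s <= t -> t <= 1 -> normc (f t - f s) <= K * (t - s)) ->
  AC 0 1 f.
Proof.
move=> fK e e0; exists (e / (`|K| + 1)); first by rewrite divr_gt0// ltr_wpDl.
move=> n s t st _; rewrite ltr_pdivlMr ?ltr_wpDl// => h.
apply: le_lt_trans h; rewrite mulrC mulr_sumr; apply: ler_sum => i _.
have /and3P[si sti ti] := st i.
rewrite (le_trans (fK _ _ si sti ti))// ler_wpM2r ?subr_ge0//.
by rewrite ler_wpDr// ler_norm.
Qed.

(** The mean value theorem fails for complex values; it is applied to the real
    and imaginary parts, at the price of a factor 2 in the Lipschitz constant. *)
Lemma AC_cderive f df (K : R) : (forall x, is_cderive x f (df x)) ->
  (forall x, 0 <= x <= 1 -> normc (df x) <= K) -> AC 0 1 f.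
Proof.
move=> fd dK; apply: (@AC_lipschitz _ (K + K)) => s t s0 st t1.
have part (h dh : R -> R) : (forall x, is_derive x (1 : R) h (dh x)) ->
    (forall x, 0 <= x <= 1 -> `|dh x| <= K) -> `|h t - h s| <= K * (t - s).
  move=> hd hK; have [|c] := @MVT_segment R h dh s t st (fun x _ => hd x).
  - apply: derivable_within_continuous => x _.
    by have [] := hd x.
  - rewrite in_itv /= => /andP[sc ct] ->.
    rewrite normrM (ger0_norm (_ : 0 <= t - s)) ?subr_ge0//.
    by rewrite ler_wpM2r ?subr_ge0// hK// (le_trans s0)// (le_trans ct).
apply: le_trans (normc_le_ReIm _) _; rewrite mulrDl.
have hR := part _ _ (fun x => (fd x).1).
have hI := part _ _ (fun x => (fd x).2).
have := lerD (hR _) (hI _); case: (f t) (f s) => [? ?] [? ?] /=; apply.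
  by move=> x /dK; exact/le_trans/(normc_ge_ReIm _).1.
by move=> x /dK; exact/le_trans/(normc_ge_ReIm _).2.
Qed.

Lemma AC_cst z : AC 0 1 (fun=> z).
Proof. by apply: (@AC_lipschitz _ 0) => *; rewrite subrr mul0r Normc.normc0. Qed.

Lemma AC_id : AC 0 1 (fun t => t%:C).
Proof.
apply: (@AC_cderive _ (fun=> 1) 1) => x; first exact: is_cderive_id.
by rewrite Normc.normc1.
Qed.

Lemma AC_cexp r : AC 0 1 (cexp r).
Proof.
apply: (@AC_cderive _ (fun x => r * cexp r x) (normc r * expR `|complex.Re r|)).
  exact: is_cderive_cexp.
move=> x /andP[x0 x1]; rewrite Normc.normcM normc_cexp ler_wpM2l ?normc_ge0//.
rewrite ler_expR (le_trans (ler_norm _))// normrM (ger0_norm x0).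
by rewrite ler_piMr.
Qed.

Lemma ACD f g : AC 0 1 f -> AC 0 1 g -> AC 0 1 (fun x => f x + g x).
Proof.
move=> fAC gAC e e0; have e20 : 0 < e / 2 by rewrite divr_gt0.
have [d1 d10 h1] := fAC _ e20; have [d2 d20 h2] := gAC _ e20.
exists (Num.min d1 d2); first by rewrite lt_min d10.
move=> n s t st tI; rewrite lt_min => /andP[l1 l2].
rewrite [ltRHS]splitr.
apply: le_lt_trans (ltrD (h1 _ _ _ st tI l1) (h2 _ _ _ st tI l2)).
rewrite -big_split /=; apply: ler_sum => i _.
by rewrite opprD addrACA normcD.
Qed.

Lemma ACM f g : AC 0 1 f -> AC 0 1 g -> AC 0 1 (fun x => f x * g x).
Proof.
move=> fAC gAC e e0; have [B B0 fB] := AC_bounded fAC; have [D D0 gD] := AC_bounded gAC.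
have e1 : 0 < e / 2 / D by rewrite !divr_gt0.
have e2 : 0 < e / 2 / B by rewrite !divr_gt0.
have [d1 d10 h1] := fAC _ e1; have [d2 d20 h2] := gAC _ e2.
exists (Num.min d1 d2); first by rewrite lt_min d10.
move=> n s t st tI; rewrite lt_min => /andP[l1 l2].
have := h1 _ _ _ st tI l1; rewrite ltr_pdivlMr// => H1.
have := h2 _ _ _ st tI l2; rewrite ltr_pdivlMr// => H2.
rewrite [ltRHS]splitr; apply: le_lt_trans (ltrD H1 H2).
rewrite !mulr_suml -big_split /=; apply: ler_sum => i _.
have /and3P[si sti ti] := st i.
have -> : f (t i) * g (t i) - f (s i) * g (s i) =
  (f (t i) - f (s i)) * g (t i) + (g (t i) - g (s i)) * f (s i) by ring.
apply: le_trans (normcD _ _) _; rewrite !Normc.normcM.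
by apply: lerD; apply: ler_wpM2l; rewrite ?normc_ge0// ?fB ?gD// ?si ?ti ?(le_trans si)// (le_trans sti).
Qed.

Lemma ACZ z f : AC 0 1 f -> AC 0 1 (fun x => z * f x).
Proof. exact/ACM/AC_cst. Qed.

(** The function exp (- r x) f is absolutely continuous with null derivative
    almost everywhere. *)
Lemma AC_linear_ode r f : AC 0 1 f ->
  ae01 (fun x => is_cderive x f (r * f x)) ->
  forall x, 0 <= x <= 1 -> f x = f 0 * cexp r x.
Proof.
move=> fAC fd x /andP[x0 x1].
pose h t := cexp (- r) t * f t.
have hAC : AC 0 1 h by apply: ACM fAC; exact: AC_cexp.
have hx : h x = h 0.
  apply: (AC_ae_derive0_const x0); first exact: AC_sub hAC.
  apply: (@filterS _ _ (ae_filter_ringOfSetsType (@lebesgue_measure R))) fd => t H /=; rewrite in_itv/= => /andP[t0 tx].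
  have /H ft : `]0, 1[%classic t by rewrite /= in_itv/= t0 (lt_le_trans tx).
  have := is_cderiveM (is_cderive_cexp (- r) t) ft.
  by rewrite [X in is_cderive _ _ X -> _](_ : _ = 0)//; ring.
move: hx; rewrite /h cexp0 mul1r => <-.
by rewrite mulrAC cexpNK mul1r.
Qed.
End Calculus.

(** * The boundary conditions as linear equations *)

Section BoundaryAlgebra.
Variable F : fieldType.
Implicit Types c d e a k l u v x : F.

Lemma lincomb_eq0 k l u v x : u = 0 -> v = 0 -> x = k * u + l * v -> x = 0.
Proof. by move=> -> -> ->; rewrite !mulr0 addr0. Qed.

(** Both vectors are orthogonal to (e1 - 1, e2 - 1), which is not zero. *)
Lemma bc_proportional e1 e2 c1 c2 d1 d2 : e1 * e2 != 1 ->
  c1 + c2 = c1 * e1 + c2 * e2 -> d1 + d2 = d1 * e1 + d2 * e2 -> c1 * d2 = d1 * c2.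
Proof.
move=> e12 hc hd; apply/eqP; rewrite -subr_eq0.
have hc0 : c1 * e1 + c2 * e2 - (c1 + c2) = 0 by rewrite hc subrr.
have hd0 : d1 * e1 + d2 * e2 - (d1 + d2) = 0 by rewrite hd subrr.
have E1 : (c1 * d2 - d1 * c2) * (e1 - 1) = 0.
  by apply: (lincomb_eq0 (k := d2) (l := - c2) hc0 hd0); ring.
have E2 : (c1 * d2 - d1 * c2) * (e2 - 1) = 0.
  by apply: (lincomb_eq0 (k := - d1) (l := c1) hc0 hd0); ring.
move/eqP: E1; rewrite mulf_eq0 => /orP[//|/eqP/subr0_eq e1E].
move/eqP: E2; rewrite mulf_eq0 => /orP[//|/eqP/subr0_eq e2E].
by move: e12; rewrite e1E e2E mulr1 eqxx.
Qed.

(** The conditions y(0) = y(1/2) = y(1) for y = (c1 x + c2) exp (r x), with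
    e = exp (r / 2). *)
Lemma bc_double_root e c1 c2 : e != 0 -> e != 1 -> 2%:R != 0 :> F ->
  c2 = (c1 / 2%:R + c2) * e -> (c1 / 2%:R + c2) * e = (c1 + c2) * e ^+ 2 ->
  c1 = 0 /\ c2 = 0.
Proof.
move=> e0 e1 n2 h1 h2.
have e10 : e - 1 != 0 by rewrite subr_eq0.
have H1 : (c1 / 2%:R + c2) * e - c2 = 0 by rewrite -h1 subrr.
have H2 : (c1 + c2) * e ^+ 2 - (c1 / 2%:R + c2) * e = 0 by rewrite h2 subrr.
have E : c1 * (e * (e - 1)) = 0.
  by apply: (lincomb_eq0 (k := - (2%:R * e)) (l := 2%:R) H1 H2); field.
have c10 : c1 = 0.
  by move/eqP: E; rewrite !mulf_eq0 (negPf e0) (negPf e10) !orbF => /eqP.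
split=> //; move: H1; rewrite c10 mul0r add0r -{2}[c2]mulr1 -mulrBr => /eqP.
by rewrite mulf_eq0 (negPf e10) orbF => /eqP.
Qed.

(** The four equations are the boundary conditions for
    g = c1 exp (r1 x) + c2 exp (r2 x) and for
    z = d1 exp (r1 x) + d2 exp (r2 x)
        + 2 a x (c1 exp (r1 x) - c2 exp (r2 x)).
    Those of g leave two possibilities.  If e1 = e2, then c2 = - c1.
    Otherwise ci = 0 unless ei = 1, and e1, e2 are not both 1.  In each case,
    eliminating d1 and d2 from those of z shows that a nonzero multiple of the
    remaining coefficient is zero. *)
Lemma bc_chain e1 e2 a c1 c2 d1 d2 :
  e1 != 0 -> e2 != 0 -> e1 * e2 != 1 -> a != 0 -> 2%:R != 0 :> F ->
  c1 + c2 = c1 * e1 + c2 * e2 ->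
  c1 * e1 + c2 * e2 = c1 * e1 ^+ 2 + c2 * e2 ^+ 2 ->
  d1 + d2 = d1 * e1 + d2 * e2 + a * (c1 * e1 - c2 * e2) ->
  d1 * e1 + d2 * e2 + a * (c1 * e1 - c2 * e2) =
    d1 * e1 ^+ 2 + d2 * e2 ^+ 2 + 2%:R * a * (c1 * e1 ^+ 2 - c2 * e2 ^+ 2) ->
  c1 = 0 /\ c2 = 0.
Proof.
move=> e10 e20 e12 a0 n2 /esym/eqP; rewrite -subr_eq0 => /eqP h1.
move=> /esym/eqP; rewrite -subr_eq0 => /eqP h2.
move=> /esym/eqP; rewrite -subr_eq0 => /eqP h3.
move=> /esym/eqP; rewrite -subr_eq0 => /eqP h4.
have [E|ne] := eqVneq e1 e2.
  subst e2.
  have e1n : e1 - 1 != 0.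
    by rewrite subr_eq0; apply: contra e12 => /eqP ->; rewrite mulr1.
  have c12 : c2 = - c1.
    by apply: (mulIf e1n); apply/eqP; rewrite -subr_eq0; apply/eqP; rewrite -h1; ring.
  have : c1 * (2%:R * a * e1 * (e1 - 1)) = 0.
    by apply: (lincomb_eq0 (k := - e1) (l := 1) h3 h4); rewrite c12; ring.
  move/eqP; rewrite !mulf_eq0 (negPf n2) (negPf a0) (negPf e10) (negPf e1n) !orbF => /eqP c10.
  by rewrite c12 c10 oppr0.
have ne0 : e1 - e2 != 0 by rewrite subr_eq0.
have A0 : c1 * (e1 - 1) = 0.
  by apply: (mulIf ne0); rewrite mul0r; apply: (lincomb_eq0 (k := - e2) (l := 1) h1 h2); ring.
have B0 : c2 * (e2 - 1) = 0 by apply: (lincomb_eq0 (k := 1) (l := - 1) h1 A0); ring.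
have [e11|e1n] := eqVneq e1 1.
  have e2n : e2 - 1 != 0.
    by rewrite subr_eq0; apply: contra e12 => /eqP ->; rewrite e11 mulr1.
  have c20 : c2 = 0 by move/eqP: B0; rewrite mulf_eq0 (negPf e2n) orbF => /eqP.
  split=> //; have : c1 * (a * (e2 - 1)) = 0.
    by apply: (lincomb_eq0 (k := e2) (l := - 1) h3 h4); rewrite c20 e11; ring.
  by move/eqP; rewrite !mulf_eq0 (negPf a0) (negPf e2n) !orbF => /eqP.
have c10 : c1 = 0.
  by move/eqP: A0; rewrite mulf_eq0 subr_eq0 (negPf e1n) orbF => /eqP.
split=> //.
have [e21|e2n] := eqVneq e2 1; last first.
  by move/eqP: B0; rewrite mulf_eq0 subr_eq0 (negPf e2n) orbF => /eqP.
have : c2 * (a * (e1 - 1)) = 0.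
  by apply: (lincomb_eq0 (k := - e1) (l := 1) h3 h4); rewrite c10 e21; ring.
by move/eqP; rewrite !mulf_eq0 (negPf a0) subr_eq0 (negPf e1n) !orbF => /eqP.
Qed.

End BoundaryAlgebra.

(** * The three-point problem for a factored equation *)

Section BoundaryProblem.
Variable R : realType.
Implicit Types (x : R) (r z : R[i]) (f Y W : R -> R[i]).

Local Notation AC := (@Defs.AC R).
Local Notation half := (2^-1 : R).

(** Here Y' = Y1 and Y'' - s Y' + p Y = f; the operator on the left is
    (D - r1) (D - r2) when s = r1 + r2 and p = r1 r2. *)
Definition ode_sol (s p : R[i]) f Y Y1 :=
  [/\ AC 0 1 Y, AC 0 1 Y1, ae01 (fun x => is_cderive x Y (Y1 x)) &
      ae01 (fun x => is_cderive x Y1 (s * Y1 x - p * Y x + f x))].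

(** (D - r1) annihilates Y' - r2 Y. *)
Lemma ode_sol_factor r1 r2 Y Y1 :
  ode_sol (r1 + r2) (r1 * r2) (fun=> 0) Y Y1 ->
  exists c, forall x, 0 <= x <= 1 -> Y1 x - r2 * Y x = c * cexp r1 x.
Proof.
move=> [YAC Y1AC dY dY1]; exists (Y1 0 + - r2 * Y 0) => x x01.
rewrite -mulNr.
apply: (@AC_linear_ode _ r1 (fun x => Y1 x + - r2 * Y x)) => //.
  by apply: ACD => //; exact: ACZ.
apply: ae01S (ae01I dY dY1) => t _ [d d1].
have := is_cderiveD d1 (is_cderiveZ (- r2) d).
by rewrite [X in is_cderive _ _ X -> _](_ : _ = r1 * (Y1 t + - r2 * Y t))//; ring.
Qed.

(** As r1 != r2, the values of Y' - r2 Y and Y' - r1 Y determine Y and Y':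
    no second integration is needed. *)
Lemma ode_sol_distinct r1 r2 Y Y1 : r1 != r2 ->
  ode_sol (r1 + r2) (r1 * r2) (fun=> 0) Y Y1 ->
  exists c1 c2, forall x, 0 <= x <= 1 ->
    Y x = c1 * cexp r1 x + c2 * cexp r2 x /\
    Y1 x = r1 * c1 * cexp r1 x + r2 * c2 * cexp r2 x.
Proof.
move=> r12 sol; have [k1 h1] := ode_sol_factor sol.
have [k2 h2] : exists c, forall x, 0 <= x <= 1 -> Y1 x - r1 * Y x = c * cexp r2 x.
  by apply: ode_sol_factor; rewrite addrC mulrC.
have r0 : r1 - r2 != 0 by rewrite subr_eq0.
exists (k1 / (r1 - r2)), (- k2 / (r1 - r2)) => x x01.
have {}h1 := h1 x x01; have {}h2 := h2 x x01.
have -> : k1 / (r1 - r2) * cexp r1 x = (Y1 x - r2 * Y x) / (r1 - r2).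
  by rewrite h1 mulrAC.
have -> : - k2 / (r1 - r2) * cexp r2 x = - (Y1 x - r1 * Y x) / (r1 - r2).
  by rewrite h2 !mulNr mulrAC.
have -> : r1 * (k1 / (r1 - r2)) * cexp r1 x = r1 * (Y1 x - r2 * Y x) / (r1 - r2).
  by rewrite h1; ring.
have -> : r2 * (- k2 / (r1 - r2)) * cexp r2 x = - r2 * (Y1 x - r1 * Y x) / (r1 - r2).
  by rewrite h2; ring.
by split; field.
Qed.

(** Subtracting k x exp (r x) from Y leaves a solution of u' = r u. *)
Lemma ode_sol_double r Y Y1 : ode_sol (r + r) (r * r) (fun=> 0) Y Y1 ->
  exists c1 c2, forall x, 0 <= x <= 1 -> Y x = (c1 * x%:C + c2) * cexp r x.
Proof.
move=> sol; have [k hk] := ode_sol_factor sol.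
have [YAC Y1AC dY _] := sol.
exists k, (Y 0) => x x01.
have := @AC_linear_ode _ r (fun x => Y x + (- k) * (x%:C * cexp r x)).
move=> /(_ _ _ x x01) H.
have : Y x + - k * (x%:C * cexp r x) = Y 0 * cexp r x.
  rewrite H ?mul0r ?mulr0 ?addr0//.
    by apply: ACD => //; apply: ACZ; apply: ACM; [exact: AC_id|exact: AC_cexp].
  apply: ae01S dY => t /andP[t0 t1] d.
  have := is_cderiveD d (is_cderiveZ (- k)
    (is_cderiveM (is_cderive_id t) (is_cderive_cexp r t))).
  have {}hk := hk t; rewrite (ltW t0) (ltW t1) in hk.
  have -> : Y1 t = r * Y t + k * cexp r t by rewrite -hk// addrC subrK.
  by rewrite [X in is_cderive _ _ X -> _](_ : _ = r * (Y t + - k * (t%:C * cexp r t)))//; ring.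
by move=> E; rewrite mulrDl -E; ring.
Qed.

Definition three_point Y := Y 0 = Y half /\ Y half = Y 1.

Variables (s : R) (r1 r2 : R[i]).
Hypotheses (s0 : s != 0) (rs : r1 + r2 = s%:C).

Lemma cexp_at1 r : cexp r 1 = cexp r half ^+ 2.
Proof. by rewrite expr2 -cexpDr (_ : half + half = 1)//; field. Qed.

Lemma cexp_half_neq0 r : cexp r half != 0.
Proof.
by apply/eqP => E; have := cexpNK r half; rewrite E mulr0 => /esym/eqP; rewrite oner_eq0.
Qed.

(** The product is the exponential of the nonzero real number s / 2: this is
    where the reality of s enters. *)
Lemma cexp_half_prod_neq1 : cexp r1 half * cexp r2 half != 1.
Proof.
rewrite -cexpDl rs cexp_real; apply/eqP => -[E].
have /eqP : s * half = 0 by apply: (@expR_inj R); rewrite E expR0.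
by rewrite mulf_eq0 (negPf s0) invr_eq0 pnatr_eq0.
Qed.

Lemma two_neq0 : 2%:R != 0 :> R[i].
Proof. by rewrite pnatr_eq0. Qed.

Lemma in01_half : 0 <= half <= 1.
Proof. by rewrite invr_ge0 ler0n invf_le1 ?ltr0n// ler1n. Qed.
Lemma in01_0 : 0 <= (0 : R) <= 1.
Proof. by rewrite lexx ler01. Qed.
Lemma in01_1 : 0 <= (1 : R) <= 1.
Proof. by rewrite lexx ler01. Qed.

Lemma real_complex_half : half%:C = 2%:R^-1 :> R[i].
Proof. by rewrite fmorphV rmorph_nat. Qed.

Lemma bvp_double_root Y Y1 : r1 = r2 ->
  ode_sol (r1 + r2) (r1 * r2) (fun=> 0) Y Y1 -> three_point Y ->
  forall x, 0 <= x <= 1 -> Y x = 0.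
Proof.
move=> r12; rewrite -r12 => /ode_sol_double[c1 [c2 Yx]] [bc1 bc2] x x01.
have e1 : cexp r1 half != 1.
  by apply: contra cexp_half_prod_neq1 => /eqP E; rewrite -r12 E mulr1.
have [||c10 c20] := bc_double_root (cexp_half_neq0 r1) e1 two_neq0 (c1 := c1) (c2 := c2).
- move: bc1; rewrite !Yx ?in01_half ?in01_0// cexp0 !mulr1.
  by rewrite real_complex_half mulr0 add0r.
- move: bc2; rewrite !Yx ?in01_half ?in01_1// cexp_at1.
  by rewrite real_complex_half mulr1.
by rewrite Yx// c10 c20 mul0r add0r mul0r.
Qed.

Lemma bvp_coeff Y c1 c2 : three_point Y ->
  (forall x, 0 <= x <= 1 -> Y x = c1 * cexp r1 x + c2 * cexp r2 x) ->
  c1 + c2 = c1 * cexp r1 half + c2 * cexp r2 half /\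
  c1 * cexp r1 half + c2 * cexp r2 half =
    c1 * cexp r1 half ^+ 2 + c2 * cexp r2 half ^+ 2.
Proof.
move=> [bc1 bc2] Yx; move: bc1 bc2.
by rewrite !Yx ?in01_half ?in01_0 ?in01_1// !cexp_at1 !cexp0 !mulr1.
Qed.

Lemma bvp_proportional Y Y1 Z Z1 :
  ode_sol (r1 + r2) (r1 * r2) (fun=> 0) Y Y1 -> three_point Y ->
  ode_sol (r1 + r2) (r1 * r2) (fun=> 0) Z Z1 -> three_point Z ->
  (forall x, 0 <= x <= 1 -> Y x = 0) \/
  exists k, forall x, 0 <= x <= 1 -> Z x = k * Y x.
Proof.
move=> solY bcY solZ bcZ; have [r12|r12] := eqVneq r1 r2.
  by left; exact: bvp_double_root solY bcY.
have [c1 [c2 hY]] := ode_sol_distinct r12 solY.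
have [d1 [d2 hZ]] := ode_sol_distinct r12 solZ.
have [hc _] := bvp_coeff bcY (fun x x01 => (hY x x01).1).
have [hd _] := bvp_coeff bcZ (fun x x01 => (hZ x x01).1).
have H := bc_proportional cexp_half_prod_neq1 hc hd.
have [c10|c10] := eqVneq c1 0.
  have [c20|c20] := eqVneq c2 0.
    by left=> x x01; rewrite (hY x x01).1 c10 c20 !mul0r addr0.
  right; exists (d2 / c2) => x x01; rewrite (hY x x01).1 (hZ x x01).1.
  have -> : d1 = 0.
    by apply: (mulIf c20); rewrite -H c10 !mul0r.
  by rewrite c10 !mul0r !add0r; field.
right; exists (d1 / c1) => x x01; rewrite (hY x x01).1 (hZ x x01).1.
have -> : d2 = d1 * c2 / c1 by rewrite -H; field.
by field.
Qed.

(** The particular solution k x H, where H = 2 G' - (r1 + r2) G, is written in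
    terms of G and G', so that its absolute continuity and its derivatives come
    from those of G; the function W = Z - k x H solves the homogeneous equation. *)
Lemma bvp_no_chain (b : R[i]) G G1 Z Z1 : b != 0 ->
  ode_sol (r1 + r2) (r1 * r2) (fun=> 0) G G1 -> three_point G ->
  ode_sol (r1 + r2) (r1 * r2) (fun x => G x / b) Z Z1 -> three_point Z ->
  forall x, 0 <= x <= 1 -> G x = 0.
Proof.
move=> b0 solG bcG solZ bcZ; have [r12|r12] := eqVneq r1 r2.
  exact: bvp_double_root solG bcG.
have r0 : r1 - r2 != 0 by rewrite subr_eq0.
pose k := (b * (r1 - r2) ^+ 2)^-1.
have kE : k * (r1 - r2) ^+ 2 = b^-1 by rewrite /k; field; rewrite b0 r0.
pose H t := 2%:R * G1 t + - (r1 + r2) * G t.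
(* H1 is the derivative of H, computed with G'' = (r1 + r2) G' - r1 r2 G. *)
pose H1 t := (r1 + r2) * G1 t + - (2%:R * (r1 * r2)) * G t.
pose W t := Z t + - k * (t%:C * H t).
pose W1 t := Z1 t + - k * (H t + t%:C * H1 t).
have solW : ode_sol (r1 + r2) (r1 * r2) (fun=> 0) W W1.
  have [GAC G1AC dG dG1] := solG; have [ZAC Z1AC dZ dZ1] := solZ.
  have HAC : AC 0 1 H by apply: ACD; exact: ACZ.
  have H1AC : AC 0 1 H1 by apply: ACD; exact: ACZ.
  have ACx := @AC_id R.
  split.
  - by apply: ACD => //; apply: ACZ; exact: ACM.
  - by apply: ACD => //; apply: ACZ; apply: ACD => //; exact: ACM.
  - apply: ae01S (ae01I dZ (ae01I dG dG1)) => t _ [z [g g1]].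
    have h := is_cderiveD (is_cderiveZ 2%:R g1) (is_cderiveZ (- (r1 + r2)) g).
    have := is_cderiveD z (is_cderiveZ (- k) (is_cderiveM (is_cderive_id t) h)).
    by rewrite [X in is_cderive _ _ X -> _](_ : _ = W1 t)// /W1 /H /H1; ring.
  - apply: ae01S (ae01I dZ1 (ae01I dG dG1)) => t _ [z1 [g g1]].
    have h := is_cderiveD (is_cderiveZ 2%:R g1) (is_cderiveZ (- (r1 + r2)) g).
    have h1 := is_cderiveD (is_cderiveZ (r1 + r2) g1)
      (is_cderiveZ (- (2%:R * (r1 * r2))) g).
    have := is_cderiveD z1 (is_cderiveZ (- k)
      (is_cderiveD h (is_cderiveM (is_cderive_id t) h1))).
    rewrite [X in is_cderive _ _ X -> _](_ : _ =
      (r1 + r2) * W1 t - r1 * r2 * W t + 0)// /W1 /W /H /H1 -kE; ring.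
have [c1 [c2 hG]] := ode_sol_distinct r12 solG.
have [d1 [d2 hW]] := ode_sol_distinct r12 solW.
have HE t : 0 <= t <= 1 -> H t = (r1 - r2) * (c1 * cexp r1 t - c2 * cexp r2 t).
  by move=> /hG[]; rewrite /H => -> ->; ring.
have ZE t : 0 <= t <= 1 -> Z t = d1 * cexp r1 t + d2 * cexp r2 t +
    k * (r1 - r2) * t%:C * (c1 * cexp r1 t - c2 * cexp r2 t).
  move=> t01; rewrite -(hW t t01).1 /W HE//; ring.
have [hc hc'] := bvp_coeff bcG (fun x x01 => (hG x x01).1).
have a0 : k * (r1 - r2) / 2%:R != 0.
  by rewrite !mulf_neq0 ?invr_neq0 ?two_neq0// mulf_neq0// expf_neq0.
have [||c10 c20] := bc_chain (cexp_half_neq0 r1) (cexp_half_neq0 r2) cexp_half_prod_neq1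
    a0 two_neq0 hc hc' (d1 := d1) (d2 := d2).
- move: bcZ.1; rewrite !ZE ?in01_half ?in01_0// real_complex_half !cexp0 !mulr1.
  by rewrite mulr0 mul0r addr0.
- move: bcZ.2; rewrite !ZE ?in01_half ?in01_1// real_complex_half !cexp_at1 mulr1 => ->.
  by congr (_ + _); field.
by move=> x x01; rewrite (hG x x01).1 c10 c20 !mul0r addr0.
Qed.

End BoundaryProblem.

(** * The operator and its kernels *)

Section Operator.
Variable R : realType.
Implicit Types (y f g Y : R -> R[i]) (k z : R[i]).

Lemma L2w_scale (w : R) k f g : 0 <= w -> L2w w f ->
  ae_eq01 g (fun x => k * f x) -> L2w w g.
Proof.
move=> w0 [h fh [mR mI hint]] gkf.
exists (fun x => k * h x); first by apply: ae01S (ae01I fh gkf) => x _ [-> ->].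
have [a [b kE]] : exists a b, k = a +i* b by case: k {gkf} => a b; exists a, b.
split.
- have -> : (fun x => complex.Re (k * h x)) =
      (fun x => a * complex.Re (h x) - b * complex.Im (h x)).
    by apply/funext => x; rewrite kE; case: (h x).
  by apply: measurable_funB; apply: measurable_funM.
- have -> : (fun x => complex.Im (k * h x)) =
      (fun x => a * complex.Im (h x) + b * complex.Re (h x)).
    by apply/funext => x; rewrite kE; case: (h x).
  by apply: measurable_funD; apply: measurable_funM.
- under eq_integral.
    move=> x _.
    rewrite Normc.normcM exprMn -mulrA EFinM.
    over.
  rewrite ge0_integralZl//=.
  + apply: lte_mul_pinfty => //; rewrite ?lee_fin ?sqr_ge0//.
  + apply/measurable_EFinP; apply: measurable_funM => //.
    have -> : (fun x => Normc.normc (h x) ^+ 2) =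
        (fun x => complex.Re (h x) ^+ 2 + complex.Im (h x) ^+ 2).
      by apply/funext => x; case: (h x) => u v /=; rewrite sqr_sqrtr// addr_ge0 ?sqr_ge0.
    by apply: measurable_funD; apply: measurable_funX.
  + by move=> x _; rewrite lee_fin mulr_ge0 ?sqr_ge0.
  + by rewrite lee_fin sqr_ge0.
Qed.

Variables (b0 b1 : R) (lam : R[i]).
Hypotheses (b0_lt0 : b0 < 0) (b1_neq0 : b1 != 0).

Local Notation T := (op_sub_scalar (opL b0 b1) lam).

Let b0C_neq0 : b0%:C != 0 :> R[i].
Proof. by rewrite fmorph_eq0 lt_eqF. Qed.

Lemma opL_scale k y y' g : opL b0 b1 y g -> ae_eq01 y' (fun x => k * y x) ->
  opL b0 b1 y' (fun x => k * g x).
Proof.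
have w0 : 0 <= - b0^-1 by rewrite oppr_ge0 invr_le0 ltW.
move=> [yL gL [Y [Y1 [Y2 [yY [YAC Y1AC] [dY dY1] gE [bc1 bc2]]]]]] yy'.
split; first exact: L2w_scale yL yy'.
  by apply: (L2w_scale w0 gL (k := k)); exact: ae01W.
exists (fun x => k * Y x), (fun x => k * Y1 x), (fun x => k * Y2 x); split.
- by apply: ae01S (ae01I yY yy') => x _ [-> ->].
- by split; exact: ACZ.
- split; first by move=> x /dY; exact: is_cderiveZ.
  by apply: ae01S dY1 => x _; exact: is_cderiveZ.
- by apply: ae01S gE => x _ ->; ring.
- by rewrite bc1 bc2.
Qed.

(** With [op_ker_proportional], the kernel is the line spanned by any of its
    nonzero elements. *)
Lemma op_ker_scale k y y' : op_ker T y -> ae_eq01 y' (fun x => k * y x) -> op_ker T y'.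
Proof.
move=> [g Lg g0] yy'; exists (fun x => k * g x); first exact: opL_scale yy'.
by apply: ae01S (ae01I g0 yy') => x _ [h ->]; rewrite mulrCA -mulrBr -h mulr0.
Qed.

(** Since f may be replaced by any F equal to it almost everywhere, F can be
    the continuous representative of f when f is itself in the domain. *)
Lemma op_ode r1 r2 y f : r1 + r2 = (- (b1 / b0))%:C -> r1 * r2 = - lam / b0%:C ->
  T y f -> exists Y Y1, [/\ ae_eq01 y Y, three_point Y &
    forall F, ae_eq01 f F -> ode_sol (r1 + r2) (r1 * r2) (fun x => F x / b0%:C) Y Y1].
Proof.
move=> rs rp [g [_ _ [Y [Y1 [Y2 [yY [YAC Y1AC] [dY dY1] gE bc]]]]] fg].
exists Y, Y1; split=> // F fF; split=> //; first exact: ae01W.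
apply: ae01S (ae01I (ae01I yY fF) (ae01I dY1 (ae01I gE fg))) => x _ [[h1 h2] [h3 [h4 h5]]].
move: h3; rewrite [X in is_cderive _ _ X -> _](_ : _ =
  (r1 + r2) * Y1 x - r1 * r2 * Y x + F x / b0%:C)//.
rewrite -h2 h5 h4 h1 rs rp rmorphN fmorph_div /=.
by field.
Qed.

Lemma char_roots : exists r1 r2 : R[i],
  r1 + r2 = (- (b1 / b0))%:C /\ r1 * r2 = - lam / b0%:C.
Proof.
set s := (_)%:C; set p := _ / _.
pose d := sqrtC (s ^+ 2 - 4%:R * p).
have dE : d ^+ 2 = s ^+ 2 - 4%:R * p by exact: sqrtCK.
exists ((s + d) / 2%:R), ((s - d) / 2%:R); split; first by field.
transitivity ((s ^+ 2 - d ^+ 2) / 4%:R); first by field.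
by rewrite dE; field.
Qed.

Let s_neq0 : - (b1 / b0) != 0.
Proof. by rewrite oppr_eq0 mulf_neq0// invr_neq0// lt_eqF. Qed.

Lemma op_ker_ode r1 r2 y : r1 + r2 = (- (b1 / b0))%:C -> r1 * r2 = - lam / b0%:C ->
  op_ker T y -> exists Y Y1, [/\ ae_eq01 y Y, three_point Y &
    ode_sol (r1 + r2) (r1 * r2) (fun=> 0) Y Y1].
Proof.
move=> rs rp Ty; have [Y [Y1 [yY bcY solY]]] := op_ode rs rp Ty.
exists Y, Y1; split=> //.
have -> : (fun=> 0) = (fun _ : R => 0 / b0%:C) by apply/funext => x; rewrite mul0r.
by apply: solY; exact: ae01W.
Qed.

Lemma op_ker_proportional y y' : op_ker T y -> ~ ae_eq01 y (fun=> 0) ->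
  op_ker T y' -> exists k, ae_eq01 y' (fun x => k * y x).
Proof.
move=> Ty y0 Ty'; have [r1 [r2 [rs rp]]] := char_roots.
have [Y [Y1 [yY bcY solY]]] := op_ker_ode rs rp Ty.
have [Z [Z1 [yZ bcZ solZ]]] := op_ker_ode rs rp Ty'.
have [Y0|[k Zk]] := bvp_proportional s_neq0 rs solY bcY solZ bcZ.
  by exfalso; apply: y0; apply: ae01S yY => x /andP[/ltW x0 /ltW x1] ->; apply: Y0; rewrite x0.
exists k; apply: ae01S (ae01I yY yZ) => x /andP[/ltW x0 /ltW x1] [-> ->].
by apply: Zk; rewrite x0.
Qed.

(** The continuous representative of g vanishes by [bvp_no_chain]. *)
Lemma op_no_chain y g : T y g -> op_ker T g -> op_ker T y.
Proof.
move=> Ty Tg; have [r1 [r2 [rs rp]]] := char_roots.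
have [G [G1 [gG bcG solG]]] := op_ker_ode rs rp Tg.
have [Z [Z1 [yZ bcZ /(_ _ gG) solZ]]] := op_ode rs rp Ty.
have G0 := bvp_no_chain s_neq0 rs b0C_neq0 solG bcG solZ bcZ.
have [h Lh gh] := Ty; exists h => //.
apply: ae01S (ae01I gG gh) => x /andP[/ltW x0 /ltW x1] [gx <-].
by rewrite gx G0// x0.
Qed.

(** From the end of the chain y, T y, T (T y) and so on, [op_no_chain] brings
    each term into the kernel in turn. *)
Lemma op_pow_ker n y : op_ker (op_pow T n.+1) y -> op_ker T y.
Proof.
elim: n y => [|n IH] y [g Tg gn]; last exact: op_no_chain Tg (IH _ gn).
by have [h Lh gh] := Tg; exists h => //; apply: ae01S (ae01I gn gh) => x _ [<-].
Qed.

End Operator.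

Theorem mainTheorem2 (R : realType) (b0 b1 : R) (hb0 : b0 < 0) (hb1 : b1 != 0)
    (lam : R[i]) (hlam : eigenvalueL b0 b1 lam) :
  alg_mult b0 b1 lam 1 /\ geom_mult b0 b1 lam 1.
Proof.
have [y Ty y0] := hlam.
have geom : geom_mult b0 b1 lam 1.
  exists (fun=> y); split.
    move=> c cy i; have -> : i = ord0 by exact: ord1.
    apply: contrapT => /eqP ci; apply: y0.
    apply: ae01S cy => x _; rewrite big_ord1 => /eqP.
    by rewrite mulf_eq0 (negPf ci) => /eqP.
  move=> z; split.
    move=> /(op_ker_proportional hb0 hb1 Ty y0)[k zk].
    by exists (fun=> k); apply: ae01S zk => x _ ->; rewrite big_ord1.
  move=> [c zc]; apply: (op_ker_scale hb0 Ty (k := c ord0)).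
  by apply: ae01S zc => x _ ->; rewrite big_ord1.
split=> //; have [e [ei eV]] := geom; exists e; split=> // z; rewrite -eV; split.
  by move=> [[//|n] _]; exact: op_pow_ker.
by move=> Tz; exists 1%N => //; exists (fun=> 0) => //; exact: ae01W.
Qed.
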